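(* Let $\mathcal{G} = (g_i)_{i=0}^{\infty}$ be a $\mathcal{G}$-adic sequence with quotients bounded by $d$, and let $0 \leq \lambda < \frac{1}{d}$. For every $i = 0,1,2,\ldots$ let $U_i$ be a proper nonempty subset of $[0,d_i-1]$ (where $d_i = g_{i+1}/g_i$), and let $\mathcal{U} = (U_i)_{i=0}^{\infty}$. Let $A_{\mathcal{G},\mathcal{U}}^{(\lambda)}$ be the set of positive integers $n$ such that, if $n \in [g_{m-1}, g_m - 1]$ has the $\mathcal{G}$-adic representation $n = \sum_{i=0}^{m-1} c_i g_i$, then \[ \operatorname{card}\{ i \in [0,m-1] : c_i \in U_i \} \leq \lambda m. \] Then there exists $\sigma < 1$ such that \[ \sum_{a \in A_{\mathcal{G},\mathcal{U}}^{(\lambda)}} \frac{1}{a^{\sigma}} < \infty. \]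
   Context: A $\mathcal{G}$-adic sequence is a strictly increasing sequence of positive integers $\mathcal{G} = (g_i)_{i=0}^{\infty}$ with $g_0 = 1$ and $g_i \mid g_{i+1}$ for all $i \geq 0$; set $d_i = g_{i+1}/g_i \geq 2$. Every positive integer $n$ has a unique $\mathcal{G}$-adic representation $n = \sum_{i=0}^{m-1} c_i g_i$ with $c_i \in \{0,1,\ldots,d_i-1\}$ for all $i$ and $c_{m-1} \neq 0$ (equivalently, $n \in [g_{m-1}, g_m-1]$). The sequence has quotients bounded by $d$ if $d_i \leq d$ for all $i \geq 0$. Here $[a,b]$ denotes the set of integers between $a$ and $b$ inclusive, and $\operatorname{card}(S)$ is the cardinality of $S$. *)

(* Defs.v *)
From HB Require Import structures.
From mathcomp Require Import all_boot all_order all_algebra.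
From mathcomp Require Import all_classical all_reals all_analysis.

Set Implicit Arguments.
Unset Strict Implicit.
Unset Printing Implicit Defensive.

Import Order.TTheory GRing.Theory Num.Theory.

Local Open Scope classical_set_scope.
Local Open Scope ring_scope.

Definition Gadic (g : nat -> nat) : Prop :=
  [/\ g 0%N = 1%N,
      {homo g : i j / (i < j)%N} &
      forall i, (g i %| g i.+1)%N].

Definition quotient (g : nat -> nat) (i : nat) : nat := (g i.+1 %/ g i)%N.

Definition quotients_bounded (g : nat -> nat) (d : nat) : Prop :=
  forall i, (quotient g i <= d)%N.

(* Only the values c 0, ..., c m.-1 matter: the digit sequence has length m. *)
Definition Gadic_repr (g : nat -> nat) (n m : nat) (c : nat -> nat) : Prop :=
  [/\ (0 < m)%N,
      (forall i, (i < m)%N -> (c i < quotient g i)%N),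
      c m.-1 <> 0%N &
      n = (\sum_(i < m) c i * g i)%N].

Definition digit_count (U : nat -> set nat) (m : nat) (c : nat -> nat) : nat :=
  #|[pred i : 'I_m | c i \in U i]|.

(* Since every positive integer has exactly one representation, quantifying
   over all (m, c) amounts to speaking of the representation of n. *)
Definition few_digits (R : realType) (g : nat -> nat) (U : nat -> set nat)
    (lambda : R) : set nat :=
  [set n | (0 < n)%N /\
    forall (m : nat) (c : nat -> nat),
      (g m.-1 <= n <= (g m).-1)%N -> Gadic_repr g n m c ->
      (digit_count U m c)%:R <= lambda * m%:R].

(* Main.v *)
(** Chernoff's method.  Fix [0 < z < 1].  The digits of [n] range independently
    over [n < g m], so [\sum_(n < g m) z ^ card {i < m : c_i \in U_i}] is a
    product over [i] of factors at most [d_i * (1 - (1 - z) / d)].  Hence at most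
    [g m * theta ^ m] of these [n] have [card <= lambda * m], where
    [theta = z ^ (- lambda) * (1 - (1 - z) / d)], and [theta < 1] as soon as
    [lambda * d < z < 1].  Since [g m <= d ^ m], the elements of the set in
    [[g m, g m.+1 - 1]] contribute [O((theta * d ^ (1 - sigma)) ^ m.+1)], which is
    summable once [sigma] is close enough to 1. *)
Require Import Defs.
From HB Require Import structures.
From mathcomp Require Import all_boot all_order all_algebra.
From mathcomp Require Import all_classical all_reals all_analysis.
From mathcomp Require Import ring lra.

Set Implicit Arguments.
Unset Strict Implicit.
Unset Printing Implicit Defensive.

Import Order.TTheory GRing.Theory Num.Theory.

Local Open Scope classical_set_scope.
Local Open Scope ring_scope.

(** * Digits in the [g]-adic system *)

(** Given by a closed formula at every index, with no reference to the length of [n], so that one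
    function serves as digit sequence for all [m]. *)
Definition digit (g : nat -> nat) (n i : nat) : nat :=
  ((n %/ g i) %% quotient g i)%N.

Section GadicDigits.
Variables (g : nat -> nat) (hg : Gadic g).

Lemma Gadic_gt0 i : (0 < g i)%N.
Proof.
case: hg => g0 gmono _; case: i => [|i]; first by rewrite g0.
by apply: leq_ltn_trans (gmono 0%N i.+1 isT).
Qed.

Lemma GadicS i : g i.+1 = (quotient g i * g i)%N.
Proof. by case: hg => _ _ gdvd; rewrite divnK. Qed.

Lemma Gadic_leq i j : (i <= j)%N -> (g i <= g j)%N.
Proof.
case: hg => _ gmono _; rewrite leq_eqVlt => /orP[/eqP -> //|ij].
exact/ltnW/gmono.
Qed.

Lemma Gadic_dvd i j : (i <= j)%N -> (g i %| g j)%N.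
Proof.
case: hg => _ _ gdvd; move=> /subnKC <-.
elim: (j - i)%N => [|k IH]; first by rewrite addn0.
by rewrite addnS (dvdn_trans IH).
Qed.

Lemma Gadic_gtid i : (i < g i)%N.
Proof.
case: hg => _ gmono _; elim: i => [|i IH]; first exact: Gadic_gt0.
exact: leq_ltn_trans IH (gmono _ _ (ltnSn i)).
Qed.

Lemma quotient_gt1 i : (1 < quotient g i)%N.
Proof.
case: hg => _ gmono _; have := gmono _ _ (ltnSn i).
by rewrite GadicS -{1}[g i]mul1n ltn_pmul2r ?Gadic_gt0.
Qed.

Lemma ltn_digit n i : (digit g n i < quotient g i)%N.
Proof. by rewrite ltn_mod (ltnW (quotient_gt1 i)). Qed.

Lemma digit_lead n m : (n < g m.+1)%N -> digit g n m = (n %/ g m)%N.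
Proof. by move=> nlt; rewrite /digit modn_small // ltn_divLR ?Gadic_gt0 // -GadicS. Qed.

Lemma digitDl c n m i : (i < m)%N -> digit g (n + c * g m) i = digit g n i.
Proof.
move=> im; rewrite /digit; have /dvdnP[k ->] := Gadic_dvd im.
by rewrite GadicS !mulnA addnC divnMDl ?Gadic_gt0 // modnMDl.
Qed.

Lemma sum_digits n m : (\sum_(i < m) digit g n i * g i = n %% g m)%N.
Proof.
elim: m => [|m IH].
  by rewrite big_ord0; case: hg => -> _ _; rewrite modn1.
rewrite big_ord_recr /= IH /digit modn_divl -GadicS.
rewrite -(modn_dvdm n (Gadic_dvd (leqnSn m))) addnC.
exact/esym/divn_eq.
Qed.

Lemma Gadic_repr_digit n m : (g m <= n < g m.+1)%N ->
  Gadic_repr g n m.+1 (digit g n).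
Proof.
case/andP=> gn ng; split => //=.
- by move=> i _; apply: ltn_digit.
- by rewrite digit_lead //; apply/eqP; rewrite -lt0n divn_gt0 ?Gadic_gt0.
- by rewrite sum_digits modn_small.
Qed.

Lemma Gadic_leX d m : quotients_bounded g d -> (g m <= d ^ m)%N.
Proof.
move=> hd; elim: m => [|m IH]; first by case: hg => ->.
by rewrite GadicS expnS leq_mul.
Qed.

(** Independence of the digits. Each [n < g m.+1] is [r + c * g m] with [r < g m] and
    [c < quotient g m]; its top digit is [c] and its lower digits are those of [r], so the sum
    factors by induction on [m]. *)
Lemma sum_prod_digits (R : comPzRingType) (phi : nat -> nat -> R) m :
  \sum_(0 <= n < g m) \prod_(i < m) phi i (digit g n i) =
  \prod_(i < m) \sum_(0 <= c < quotient g i) phi i c.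
Proof.
elim: m => [|m IH].
  by case: hg => -> _ _; rewrite big_nat1 !big_ord0.
rewrite GadicS big_nat_mul big_ord_recr /= -IH big_distrr /= big_nat [RHS]big_nat.
apply: eq_bigr => c /andP[_ cq].
rewrite mulr_suml mulSn -{1}[(c * g m)%N]add0n big_addn addnK big_nat [RHS]big_nat.
apply: eq_bigr => n /andP[_ ng]; rewrite big_ord_recr /=; congr (_ * _).
  by apply: eq_bigr => i _; rewrite digitDl.
rewrite digit_lead; last first.
  rewrite GadicS; apply: (@leq_trans (c.+1 * g m)); last by rewrite leq_mul2r cq orbT.
  by rewrite mulSn ltn_add2r.
by rewrite divnDMl ?Gadic_gt0 // divn_small.
Qed.

End GadicDigits.

(** * Exponential moments of the digit count, and the sum over one block *)

Lemma expr_digit_count (R : comPzRingType) (U : nat -> set nat) m c (z : R) :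
  z ^+ digit_count U m c = \prod_(i < m) (if c i \in U i then z else 1).
Proof. by rewrite -big_mkcond /= prodr_const. Qed.

(** In the factor of index [i], some digit lies in [U i] and weighs [z], the others weigh at most 1.
    The factor is thus at most [quotient g i - (1 - z)], and [quotient g i <= d] turns this into a
    multiple of [quotient g i]. *)
Lemma sum_expr_digit_count (R : realFieldType) g d (U : nat -> set nat) (z : R) m :
  Gadic g -> quotients_bounded g d -> (forall i, U i !=set0) ->
  (forall i, U i `<` [set k | (k < quotient g i)%N]) -> 0 <= z <= 1 ->
  \sum_(0 <= n < g m) z ^+ digit_count U m (digit g n) <=
  (g m)%:R * (1 - (1 - z) / d%:R) ^+ m.
Proof.
move=> hg hd hU0 hU /andP[z0 z1].
under eq_bigr do rewrite expr_digit_count.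
rewrite (sum_prod_digits hg (fun i c => if c \in U i then z else 1)).
have -> : (g m)%:R = \prod_(i < m) (quotient g i)%:R :> R.
  elim: m => [|m IH]; first by rewrite big_ord0; case: hg => ->.
  by rewrite big_ord_recr /= -IH GadicS // natrM mulrC.
rewrite -[X in _ ^+ X]card_ord -prodr_const -big_split /=; apply: ler_prod => i _.
apply/andP; split; first by apply: sumr_ge0 => c _; case: ifP.
have [c0 Uc0] := hU0 i; have [Usub _] := hU i; have /= c0q := Usub _ Uc0.
rewrite big_mkord (bigD1 (Ordinal c0q)) //= mem_set //.
have q0 : (0 < quotient g i)%N by apply: leq_ltn_trans c0q.
have qd : (quotient g i)%:R <= d%:R :> R by rewrite ler_nat.
have q0R : 0 < (quotient g i)%:R :> R by rewrite ltr0n.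
have : \sum_(j < quotient g i | j != Ordinal c0q) (if (j : nat) \in U i then z else 1)
   <= (quotient g i)%:R - 1 :> R.
  apply: (@le_trans _ _ (\sum_(j < quotient g i | j != Ordinal c0q) 1)).
    by apply: ler_sum => j _; case: ifP.
  have : \sum_(j < quotient g i) (1 : R) =
         1 + \sum_(j < quotient g i | j != Ordinal c0q) 1.
    by rewrite (bigD1 (Ordinal c0q)).
  by rewrite sumr_const card_ord; lra.
have d0 : 0 < d%:R :> R by apply: lt_le_trans qd.
have : (quotient g i)%:R / d%:R * (1 - z) <= 1 - z.
  by rewrite ler_piMl ?subr_ge0 // ler_pdivrMr // mul1r.
set X := (quotient g i)%:R in q0R qd *.
rewrite (_ : X * (1 - (1 - z) / d%:R) = X - X / d%:R * (1 - z)); last by ring.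
lra.
Qed.

(** With [w = 1 - z], the exponential bounds [theta * d ^ s], through
    [z ^-1 <= expR (w / (1 - w))] and [1 - w / d <= expR (- (w / d))]. *)
Lemma block_sum_le (R : realType) g d (U : nat -> set nat) (lambda w s : R) m :
  Gadic g -> quotients_bounded g d -> (forall i, U i !=set0) ->
  (forall i, U i `<` [set k | (k < quotient g i)%N]) ->
  0 < w < 1 -> 0 <= s ->
  \sum_(g m <= n < g m.+1)
     (if n \in few_digits g U lambda then 1 / n%:R `^ (1 - s) else 0) <=
  d%:R * expR (s * ln d%:R + lambda * (w / (1 - w)) - w / d%:R) ^+ m.+1.
Proof.
move=> hg hd hU0 hU /andP[w0 w1] s0.
have d1 : (1 < d)%N by apply: leq_trans (quotient_gt1 hg 0) (hd 0%N).
have d0 : 0 < d%:R :> R by rewrite ltr0n ltnW.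
have gm0 k : 0 < (g k)%:R :> R by rewrite ltr0n Gadic_gt0.
pose E := expR (lambda * (w / (1 - w))) ^+ m.+1.
pose D := expR (s * ln d%:R) ^+ m.+1.
(* Termwise Chernoff bound: [n^s <= D], [1 / n <= 1 / g m], and [E * (1 - w) ^+ count] is at least 1
   on the set and nonnegative off it. *)
have term n : (g m <= n < g m.+1)%N ->
    (if n \in few_digits g U lambda then 1 / n%:R `^ (1 - s) else 0) <=
    D * E / (g m)%:R * (1 - w) ^+ digit_count U m.+1 (digit g n) :> R.
  move=> /andP[gn ng].
  have rhs0 : 0 <= D * E / (g m)%:R * (1 - w) ^+ digit_count U m.+1 (digit g n).
    by rewrite !mulr_ge0 ?invr_ge0 ?exprn_ge0 ?expR_ge0 ?subr_ge0 ?(ltW w1) ?ltW.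
  case: ifPn => // /set_mem[_ few].
  have n0 : (0 < n)%N by apply: leq_trans gn; apply: Gadic_gt0.
  have nR : 0 < n%:R :> R by rewrite ltr0n.
  have {few} cnt : (digit_count U m.+1 (digit g n))%:R <= lambda * m.+1%:R.
    apply: few; last by apply: Gadic_repr_digit; rewrite ?gn.
    by rewrite gn -ltnS prednK ?Gadic_gt0.
  rewrite powRB; last by rewrite (gt_eqF nR) /= implybT.
  rewrite powRr1 ?(ltW nR) // mul1r invf_div.
  have nsD : n%:R `^ s <= D.
    apply: (@le_trans _ _ ((d ^ m.+1)%:R `^ s)).
      apply: ge0_ler_powR => //; rewrite ?nnegrE ?ler0n // ler_nat.
      by apply: leq_trans (ltnW ng) (Gadic_leX hg _ hd).
    rewrite /D -expRM_natr natrX /powR gt_eqF ?exprn_gt0 //.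
    by rewrite lnXn // -[ln _ *+ _]mulr_natr mulrA.
  have E1 : 1 <= E * (1 - w) ^+ digit_count U m.+1 (digit g n).
    have z1 : 0 < 1 - w by rewrite subr_gt0.
    have zexp : expR (- (w / (1 - w))) <= 1 - w.
      rewrite expRN invf_ple ?posrE ?expR_gt0 //.
      apply: le_trans _ (expR_ge1Dx _).
      rewrite [leRHS](_ : _ = (1 - w)^-1) //.
      by field; rewrite gt_eqF.
    apply: (@le_trans _ _ (E * expR (- (w / (1 - w))) ^+ digit_count U m.+1 (digit g n))).
      rewrite /E -!expRM_natr -expRD -[leLHS]expR0 ler_expR mulNr.
      rewrite subr_ge0 [leRHS]mulrAC [leLHS]mulrC ler_wpM2r // divr_ge0 ?ltW //.
    rewrite ler_wpM2l ?exprn_ge0 ?expR_ge0 //.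
    by apply: lerXn2r => //; rewrite nnegrE ?expR_ge0 ?ltW.
  apply: (@le_trans _ _ (D / (g m)%:R)).
    apply: ler_pM; rewrite ?powR_ge0 ?invr_ge0 ?ler0n //.
    by rewrite lef_pV2 ?posrE // ler_nat.
  rewrite (_ : D * E / _ * _ =
    D / (g m)%:R * (E * (1 - w) ^+ digit_count U m.+1 (digit g n))); last by ring.
  by rewrite ler_peMr // divr_ge0 ?exprn_ge0 ?expR_ge0.
rewrite big_nat_cond; under [leLHS]eq_bigl do rewrite andbT.
apply: (@le_trans _ _ (\sum_(g m <= n < g m.+1)
    D * E / (g m)%:R * (1 - w) ^+ digit_count U m.+1 (digit g n))).
  rewrite [leRHS]big_nat_cond; under [leRHS]eq_bigl do rewrite andbT.
  exact: ler_sum.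
rewrite -mulr_sumr.
have DE0 : 0 <= D * E / (g m)%:R by rewrite !mulr_ge0 ?exprn_ge0 ?expR_ge0 ?invr_ge0.
apply: (@le_trans _ _ (D * E / (g m)%:R * ((g m.+1)%:R * expR (- (w / d%:R)) ^+ m.+1))).
  rewrite ler_wpM2l //.
  (* The terms are nonnegative, so the block may be enlarged to all [n < g m.+1], where the product
     formula applies. *)
  apply: (@le_trans _ _ (\sum_(0 <= n < g m.+1)
      (1 - w) ^+ digit_count U m.+1 (digit g n))).
    rewrite (@big_cat_nat _ _ _ (g m) 0%N (g m.+1)) //= ?Gadic_leq // lerDr.
    by apply: sumr_ge0 => n _; rewrite exprn_ge0 // subr_ge0 ltW.
  apply: le_trans (sum_expr_digit_count m.+1 hg hd hU0 hU _) _.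
    by rewrite subr_ge0 gerBl !ltW.
  rewrite ler_wpM2l // subKr; apply: lerXn2r; rewrite ?nnegrE ?expR_ge0 //.
    by rewrite subr_ge0 ler_pdivrMr // mul1r (le_trans (ltW w1)) // ler1n ltnW.
  exact: expR_ge1Dx.
(* The ratio [g m.+1 / g m] is a quotient, hence at most [d]: this is the constant in front. *)
rewrite GadicS // natrM.
rewrite (_ : _ * _ = (quotient g m)%:R * (D * E * expR (- (w / d%:R)) ^+ m.+1)); last first.
  by field; rewrite gt_eqF.
rewrite /D /E -!exprMn -!expRD; apply: ler_wpM2r; first by rewrite exprn_ge0 ?expR_ge0.
by rewrite ler_nat.
Qed.

(** * Summation over the blocks and choice of the exponent *)

Lemma esum_nat_lt_pinfty (R : realType) (A : set nat) (f : nat -> R) (C : R) :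
  (forall n, 0 <= f n) ->
  (forall N, \sum_(0 <= n < N) (if n \in A then f n else 0) <= C) ->
  (\esum_(n in A) (f n)%:E < +oo)%E.
Proof.
move=> f0 fC; rewrite esum_mkcond -nneseries_esumT; last first.
  by move=> n; case: ifP => // _; rewrite lee_fin.
apply: (@le_lt_trans _ _ C%:E); last exact: ltry.
apply: lime_le; first by apply: is_cvg_nneseries => n _ _; case: ifP; rewrite ?lee_fin.
apply: nearW => N; rewrite (_ : (\sum_(0 <= n < N) _)%E =
  (\sum_(0 <= n < N) (if n \in A then f n else 0))%:E) ?lee_fin //.
by rewrite -sumEFin; apply: eq_bigr => n _; case: ifP.
Qed.

Theorem theorem4 (R : realType) (g : nat -> nat) (d : nat) (lambda : R)
    (U : nat -> set nat)
    (hg : Gadic g) (hd : quotients_bounded g d)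
    (hlambda0 : 0 <= lambda) (hlambda : lambda < 1 / d%:R)
    (hU0 : forall i, U i !=set0)
    (hU : forall i, U i `<` [set k | (k < quotient g i)%N]) :
  exists sigma : R, sigma < 1 /\
    (\esum_(a in few_digits g U lambda) (1 / (a%:R `^ sigma))%:E < +oo)%E.
Proof.
have d1 : (1 < d)%N by apply: leq_trans (quotient_gt1 hg 0) (hd 0%N).
have d0 : 0 < d%:R :> R by rewrite ltr0n ltnW.
have ld1 : lambda * d%:R < 1 by rewrite -ltr_pdivlMr.
have ld0 : 0 <= lambda * d%:R by rewrite mulr_ge0.
(* [1 - w] is the midpoint of [lambda * d] and 1, so [1 - w > lambda * d], which is exactly what
   makes the decay rate [delta] positive. *)
pose w := (1 - lambda * d%:R) / 2; pose delta := w / d%:R - lambda * (w / (1 - w)).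
have w01 : 0 < w < 1 by rewrite /w; lra.
have delta0 : 0 < delta.
  rewrite (_ : delta = w * (1 - w - lambda * d%:R) / (d%:R * (1 - w))); last first.
    by rewrite /delta; field; rewrite !gt_eqF //; lra.
  by rewrite divr_gt0 ?mulr_gt0 //; rewrite /w; lra.
have lnd : 0 < ln d%:R :> R by rewrite ln_gt0 // ltr1n.
(* Chosen so that [d^s] costs half of the decay; the ratio between block bounds is then
   [q = expR (- (delta / 2)) < 1]. *)
pose s := delta / 2 / ln d%:R.
have s0 : 0 < s by rewrite !divr_gt0.
pose q : R := expR (- (delta / 2)).
have q0 : 0 <= q by apply: expR_ge0.
have q1 : 0 < 1 - q by rewrite subr_gt0 -expR0 ltr_expR; lra.
exists (1 - s); split; first by lra.
pose h n : R := if n \in few_digits g U lambda then 1 / n%:R `^ (1 - s) else 0.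
have h0 n : 0 <= h n by rewrite /h; case: ifP; rewrite ?divr_ge0 ?powR_ge0.
(* The right side is the geometric sum of [d * q ^+ k] for [k <= M]. Block [m] uses the term
   [k = m.+1]; the term [k = 0] is to spare, as [n = 0] contributes nothing. *)
have blocks M : \sum_(0 <= n < g M) h n <= d%:R / (1 - q) * (1 - q ^+ M.+1).
  elim: M => [|M IH].
    case: (hg) => -> _ _; rewrite big_nat1 /h ifF.
      by rewrite expr1 divfK ?gt_eqF // ltW.
    by apply/negbTE/negP => /set_mem[].
  rewrite (@big_cat_nat _ _ _ (g M)) //= ?Gadic_leq //.
  rewrite (_ : _ * _ = d%:R / (1 - q) * (1 - q ^+ M.+1) + d%:R * q ^+ M.+1).
    apply: lerD => //; apply: le_trans (block_sum_le _ _ hg hd hU0 hU w01 (ltW s0)) _.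
    rewrite (_ : _ + _ - _ = - (delta / 2)) // /s divfK ?gt_eqF // /delta; lra.
  by rewrite !exprS; field; rewrite gt_eqF.
apply: (@esum_nat_lt_pinfty _ _ _ (d%:R / (1 - q))).
  by move=> n; rewrite divr_ge0 ?powR_ge0.
(* Since [N < g N], the blocks below [g N] cover every [n < N]. *)
move=> N; apply: (@le_trans _ _ (\sum_(0 <= n < g N) h n)).
  rewrite [leRHS](@big_cat_nat _ _ _ N) //= ?(ltnW (Gadic_gtid hg N)) // lerDl.
  by apply: sumr_ge0.
apply: le_trans (blocks N) _.
by rewrite ler_piMr ?gerBl ?exprn_ge0 // divr_ge0 // ltW.
Qed.
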